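(* The concrete functor $\Delta:\mathsf{ProbMet}\to\mathfrak{Z}$, which maps an object $(X,\alpha,* )$ to $(X,\{d_\lambda\mid0<\lambda\le1\})$ with $$d_\lambda(x,y)=\inf\{0\le\gamma<\infty\mid\alpha(x,y,\gamma)>1-\lambda\}$$ (with $\inf\emptyset=\infty$), is an isomorphism.
   Context: A continuous t-norm is a binary operation $*$ on $[0,1]$ such that $([0,1],*,1)$ is a commutative monoid, $*$ is continuous as a function from $[0,1]^2$ to $[0,1]$ with respect to the usual topologies, and $p*q\le p'*q'$ whenever $p\le p'$ and $q\le q'$ in $[0,1]$. A distance distribution is a monotone (nondecreasing) function $\varphi:[0,\infty]\to[0,1]$ with $\varphi(0)=0$, $\varphi(\infty)=1$, left-continuous on $]0,\infty[$. The largest distance distribution is denoted $\varepsilon_0$; it satisfies $\varepsilon_0(0)=0$ and $\varepsilon_0(t)=1$ for $t>0$. A probabilistic metric space $(X,\alpha,* )$ is a set $X$ endowed with a map $\alpha:X\times X\times[0,\infty]\to[0,1]$ and a continuous t-norm $*$ such that for all $x,y,z\in X$ and $r,s\in[0,\infty]$: (P1) $\alpha(x,y,-):[0,\infty]\to[0,1]$ is a distance distribution; (P2) $\alpha(x,x,-)=\varepsilon_0$; (P3) $\alpha(x,y,r)=\alpha(y,x,r)$; (P4) $\alpha(x,y,-)=\varepsilon_0$ implies $x=y$; (P5) $\alpha(y,z,r)*\alpha(x,y,s)\le\alpha(x,z,r+s)$. A map $f:(X,\alpha)\to(Y,\beta)$ between probabilistic metric spaces is non-expansive if $\alpha(x,x',t)\le\beta(f(x),f(x'),t)$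 for all $x,x'\in X$ and $t\in[0,\infty]$. It is always assumed that the probabilistic metric spaces are defined with respect to some continuous t-norm, which is denoted by $*$. $\mathsf{ProbMet}$ is the category of probabilistic metric spaces with non-expansive maps. A distance on $X$ is a function $d:X\times X\to[0,\infty]$ that is zero on the diagonal. $\mathfrak{Z}$ is the category with objects $(X,\{d_\lambda\mid0<\lambda\le1\})$, sets $X$ endowed with a collection of distances numbered by $0<\lambda\le1$, where $\{d_\lambda\mid0<\lambda\le1\}$ satisfies the following conditions, (UT) being required for some continuous t-norm $*$: (US) for every $0<\lambda\le1$ and all $x,y\in X$, $d_\lambda(x,y)=d_\lambda(y,x)$; (UD) for every $0<\lambda\le1$, $d_\lambda=\inf_{\rho<\lambda}d_\rho$ (pointwise, over $0<\rho<\lambda$); (UT) for all $0<\varepsilon\le1$, $0<\lambda\le1$, $0<\lambda'\le1$ with $(1-\lambda')*(1-\lambda)>1-\varepsilon$ and all $x,y,z\in X$, $d_\varepsilon(x,z)\le d_\lambda(x,y)+d_{\lambda'}(y,z)$; (UH) if $x\neq y$ then there exists $0<\lambda\le1$ with $d_\lambda(x,y)>0$. Morphisms $f:(X,\{d_\lambda\mid0<\lambda\le1\})\to(Y,\{d'_\lambda\mid0<\lambda\le1\})$ in $\mathfrak{Z}$ are the levelwise non-expansive maps: for all $\lambda$, $d'_\lambda(f(x),f(x'))\le d_\lambda(x,x')$ whenever $x,x'\in X$. A concrete functor is one that leaves underlying sets and maps unchanged. *)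

(* Defs.v *)
From HB Require Import structures.
From mathcomp Require Import all_boot all_order all_algebra.
From mathcomp Require Import all_classical all_reals all_analysis.

Set Implicit Arguments.
Unset Strict Implicit.
Unset Printing Implicit Defensive.

Import Order.TTheory GRing.Theory Num.Theory.
Import numFieldNormedType.Exports.

Local Open Scope classical_set_scope.
Local Open Scope ring_scope.

Record category := Category {
  Obj :> Type;
  mor : Obj -> Obj -> Type;
  mor_id : forall A, mor A A;
  mor_comp : forall A B C, mor B C -> mor A B -> mor A C;
  mor_comp_idl : forall A B (f : mor A B), mor_comp (mor_id B) f = f;
  mor_comp_idr : forall A B (f : mor A B), mor_comp f (mor_id A) = f;
  mor_comp_assoc : forall A B C D (h : mor C D) (g : mor B C) (f : mor A B),
    mor_comp h (mor_comp g f) = mor_comp (mor_comp h g) f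
}.

Record functor (C D : category) := Functor {
  fobj :> C -> D;
  fmor : forall A B, mor A B -> mor (fobj A) (fobj B);
  functor_mor_id : forall A, fmor (mor_id A) = mor_id (fobj A);
  functor_mor_comp : forall A B E (g : mor B E) (f : mor A B),
    fmor (mor_comp g f) = mor_comp (fmor g) (fmor f)
}.

Definition functor_id (C : category) : functor C C :=
  @Functor C C (fun A => A) (fun A B f => f)
    (fun A => erefl) (fun A B E g f => erefl).

Section FunctorComp.
Variables (C D E : category) (G : functor D E) (F : functor C D).

Lemma functor_comp_id (A : C) : fmor G (fmor F (mor_id A)) = mor_id (G (F A)).
Proof. by rewrite !functor_mor_id. Qed.

Lemma functor_comp_comp (A B A' : C) (g : mor B A') (f : mor A B) :
  fmor G (fmor F (mor_comp g f)) =
  mor_comp (fmor G (fmor F g)) (fmor G (fmor F f)).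
Proof. by rewrite !functor_mor_comp. Qed.

Definition functor_comp : functor C E :=
  @Functor C E (fun A => G (F A)) (fun A B f => fmor G (fmor F f))
    functor_comp_id functor_comp_comp.
End FunctorComp.

Definition is_isomorphism (C D : category) (F : functor C D) : Prop :=
  exists G : functor D C,
    functor_comp G F = functor_id C /\ functor_comp F G = functor_id D.

Definition SetCat : category :=
  @Category Type (fun X Y => X -> Y) (fun X x => x)
    (fun X Y Z g f x => g (f x))
    (fun X Y f => erefl) (fun X Y f => erefl)
    (fun X Y Z W h g f => erefl).

(* [UC] and [UD] are the forgetful functors of the concrete categories [C]
   and [D]; a concrete functor leaves underlying sets and maps unchanged. *)
Definition is_concrete (C D : category) (UC : functor C SetCat)
    (UD : functor D SetCat) (F : functor C D) : Prop :=
  functor_comp UD F = UC.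

(* A binary operation on [0,1] is given by a function on [R] whose values
   outside the unit square are irrelevant. *)
Record is_cont_tnorm (R : realType) (T : R -> R -> R) : Prop := IsContTNorm {
  tnorm_itv : forall p q : R, 0 <= p <= 1 -> 0 <= q <= 1 -> 0 <= T p q <= 1;
  tnormA : forall p q r : R, 0 <= p <= 1 -> 0 <= q <= 1 -> 0 <= r <= 1 ->
    T p (T q r) = T (T p q) r;
  tnormC : forall p q : R, 0 <= p <= 1 -> 0 <= q <= 1 -> T p q = T q p;
  tnorm1 : forall p : R, 0 <= p <= 1 -> T 1 p = p;
  tnorm_le : forall p p' q q' : R,
    0 <= p <= 1 -> 0 <= p' <= 1 -> 0 <= q <= 1 -> 0 <= q' <= 1 ->
    p <= p' -> q <= q' -> T p q <= T p' q';
  tnorm_cont : {within `[0, 1] `*` `[0, 1],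
    continuous (fun pq : R * R => T pq.1 pq.2)}
}.

(* The interval [[0,oo]]. *)
Definition enng (R : realType) := {t : \bar R | (0 <= t)%E}.

Definition enng_fin (R : realType) (g : {nonneg R}) : enng R :=
  exist _ g%:num%:E (ge0 g : (0 <= g%:num%:E)%E).

Definition enng_add (R : realType) (r s : enng R) : enng R :=
  exist _ (val r + val s)%E (adde_ge0 (valP r) (valP s)).

(* In [dd_lcont] the left limit is taken over real [s]; [`|s|] only serves to
   land in [[0,oo]] and equals [s] near [t > 0]. *)
Record is_distance_distribution (R : realType) (phi : enng R -> R) :
    Prop := IsDistanceDistribution {
  dd_itv : forall t, 0 <= phi t <= 1;
  dd_mono : forall s t : enng R, (val s <= val t)%E -> phi s <= phi t;
  dd0 : forall t : enng R, val t = 0%E -> phi t = 0;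
  ddoo : forall t : enng R, val t = +oo%E -> phi t = 1;
  dd_lcont : forall t : R, 0 < t ->
    (fun s : R => phi (enng_fin `|s|%:nng)) @ t^'- --> phi (enng_fin `|t|%:nng)
}.

Definition eps0 (R : realType) (t : enng R) : R :=
  if val t == 0%E then 0 else 1.

Record is_probmet_for (R : realType) (T : R -> R -> R) (X : Type)
    (alpha : X -> X -> enng R -> R) : Prop := IsProbMetFor {
  pm_P1 : forall x y, is_distance_distribution (alpha x y);
  pm_P2 : forall x, alpha x x = @eps0 R;
  pm_P3 : forall x y r, alpha x y r = alpha y x r;
  pm_P4 : forall x y, alpha x y = @eps0 R -> x = y;
  pm_P5 : forall x y z (r s : enng R),
    T (alpha y z r) (alpha x y s) <= alpha x z (enng_add r s)
}.

(* The t-norm is a property of the space (some continuous t-norm works), not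
   part of the data: otherwise the passage to the family [d_lambda], which
   forgets it, could not be injective on objects. *)
Definition is_probmet (R : realType) (X : Type)
    (alpha : X -> X -> enng R -> R) : Prop :=
  exists T : R -> R -> R, is_cont_tnorm T /\ is_probmet_for T alpha.

Record probmet (R : realType) := ProbMetSpace {
  pm_set :> Type;
  pm_alpha : pm_set -> pm_set -> enng R -> R;
  pm_ax : is_probmet pm_alpha
}.

Record pm_hom (R : realType) (A B : probmet R) := PMHom {
  pm_fun :> A -> B;
  pm_fun_le : forall (x x' : A) (t : enng R),
    pm_alpha x x' t <= pm_alpha (pm_fun x) (pm_fun x') t
}.

Section ProbMetCat.
Variable R : realType.
Implicit Types A B C D : probmet R.

Lemma pm_hom_eq A B (f g : pm_hom A B) : pm_fun f = pm_fun g -> f = g.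
Proof.
case: f g => [f fP] [g gP] /= fg; rewrite fg in fP *.
by rewrite (Prop_irrelevance fP gP).
Qed.

Definition pm_id A : pm_hom A A :=
  @PMHom R A A (fun x => x) (fun _ _ _ => lexx _).

Definition pm_comp A B C (g : pm_hom B C) (f : pm_hom A B) : pm_hom A C :=
  @PMHom R A C (fun x => g (f x))
    (fun x x' t => le_trans (pm_fun_le f x x' t) (pm_fun_le g (f x) (f x') t)).

Definition ProbMet : category :=
  @Category (probmet R) (@pm_hom R) pm_id pm_comp
    (fun A B f => @pm_hom_eq A B (pm_comp (pm_id B) f) f erefl)
    (fun A B f => @pm_hom_eq A B (pm_comp f (pm_id A)) f erefl)
    (fun A B C D h g f => @pm_hom_eq A D
      (pm_comp h (pm_comp g f)) (pm_comp (pm_comp h g) f) erefl).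

Definition ProbMet_forget : functor ProbMet SetCat :=
  @Functor ProbMet SetCat (@pm_set R) (@pm_fun R)
    (fun A => erefl) (fun A B C g f => erefl).
End ProbMetCat.

Definition level (R : realType) := {l : R | 0 < l <= 1}.

Record is_zfamily (R : realType) (X : Type)
    (d : level R -> X -> X -> \bar R) : Prop := IsZFamily {
  z_ge0 : forall l x y, (0 <= d l x y)%E;
  z_diag : forall l x, d l x x = 0%E;
  z_US : forall l x y, d l x y = d l y x;
  z_UD : forall (l : level R) x y,
    d l x y = ereal_inf [set d r x y | r in [set r : level R | val r < val l]];
  z_UT : exists T : R -> R -> R, is_cont_tnorm T /\
    forall (e l l' : level R),
      T (1 - val l') (1 - val l) > 1 - val e ->
      forall x y z, (d e x z <= d l x y + d l' y z)%E;
  z_UH : forall x y, x <> y -> exists l, (0 < d l x y)%E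
}.

Record zspace (R : realType) := ZSpace {
  z_set :> Type;
  z_dist : level R -> z_set -> z_set -> \bar R;
  z_ax : is_zfamily z_dist
}.

Record z_hom (R : realType) (A B : zspace R) := ZHom {
  z_fun :> A -> B;
  z_fun_le : forall (l : level R) (x x' : A),
    (z_dist l (z_fun x) (z_fun x') <= z_dist l x x')%E
}.

Section ZCategory.
Variable R : realType.
Implicit Types A B C D : zspace R.

Lemma z_hom_eq A B (f g : z_hom A B) : z_fun f = z_fun g -> f = g.
Proof.
case: f g => [f fP] [g gP] /= fg; rewrite fg in fP *.
by rewrite (Prop_irrelevance fP gP).
Qed.

Definition z_id A : z_hom A A :=
  @ZHom R A A (fun x => x) (fun _ _ _ => lexx _).

Definition z_comp A B C (g : z_hom B C) (f : z_hom A B) : z_hom A C :=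
  @ZHom R A C (fun x => g (f x))
    (fun l x x' => le_trans (z_fun_le g l (f x) (f x')) (z_fun_le f l x x')).

Definition ZCat : category :=
  @Category (zspace R) (@z_hom R) z_id z_comp
    (fun A B f => @z_hom_eq A B (z_comp (z_id B) f) f erefl)
    (fun A B f => @z_hom_eq A B (z_comp f (z_id A)) f erefl)
    (fun A B C D h g f => @z_hom_eq A D
      (z_comp h (z_comp g f)) (z_comp (z_comp h g) f) erefl).

Definition ZCat_forget : functor ZCat SetCat :=
  @Functor ZCat SetCat (@z_set R) (@z_fun R)
    (fun A => erefl) (fun A B C g f => erefl).
End ZCategory.

Definition delta_dist (R : realType) (X : Type)
    (alpha : X -> X -> enng R -> R) (l : level R) (x y : X) : \bar R :=
  ereal_inf [set g%:num%:E | g in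
    [set g : {nonneg R} | alpha x y (enng_fin g) > 1 - val l]].

(* Together with the object part, concreteness determines the action on
   morphisms, so at most one functor satisfies this predicate. *)
Definition is_Delta (R : realType) (F : functor (ProbMet R) (ZCat R)) : Prop :=
  is_concrete (ProbMet_forget R) (ZCat_forget R) F /\
  forall A : ProbMet R, exists dP : is_zfamily (delta_dist (@pm_alpha R A)),
    F A = ZSpace dP.

(* Main.v *)
Require Import Defs.
From mathcomp Require Import all_boot all_order all_algebra.
From mathcomp Require Import all_classical all_reals all_analysis.
From mathcomp Require Import lra.
From Stdlib Require Eqdep.

Set Implicit Arguments.
Unset Strict Implicit.
Unset Printing Implicit Defensive.

Import Order.TTheory GRing.Theory Num.Theory.
Import numFieldNormedType.Exports.

Local Open Scope classical_set_scope.
Local Open Scope ring_scope.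

(** For a distance distribution [phi] and a family [d] of distances numbered
    by levels, consider the relation

        1 - l < phi t   if and only if   d l < t,    for all real t >= 0,

    called [level_dual phi d] below.  Each side determines the other.  A number
    in [0,1] is determined by the numbers [1 - l], with 0 < l <= 1, that lie
    strictly below it, so [d] determines [phi]; an extended real in [0,oo] is
    determined by the real numbers strictly above it, so [phi] determines [d].
    In the same way, a larger [phi] corresponds to a smaller [d]
    ([level_dual_le_dist], [level_dual_le_distr]).

    Every distance distribution has a dual, its quantile function [quantile],
    which is the formula defining Delta; the equivalence above holds because
    the distribution is left-continuous ([quantile_dual]).  Every nonnegative
    family satisfying (UD) has a dual, [profile], given by
    t |-> sup {1 - l | d l < t}; here the equivalence follows from (UD)
    ([profile_dual]).  By uniqueness of duals the two constructions are
    inverse to each other ([profile_quantile], [quantile_profile]).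

    The axioms of a probabilistic metric space and of an object of the category
    of distance families correspond under this duality.  The constant
    distribution [eps0] is dual to the zero family ([level_dual_eps0]), which
    matches (P2) and (P4) with the zero diagonal and (UH).  (P5) gives (UT)
    with the same t-norm by monotonicity of the t-norm.  Conversely, (UT) only
    reaches numbers [1 - l] strictly below the two factors of (P5), and
    continuity of the t-norm allows passing to the supremum
    ([tnorm_lt_nbhs], [approx_level]).

    Order reversal makes the non-expansive maps on both sides the same, so both
    constructions are concrete functors.  Since the forgetful functors are
    faithful, a concrete functor is determined by its values on objects
    ([concrete_functor_eq]), and the equality of the two composites with the
    identity functors reduces to the uniqueness of duals. *)

(** * Concrete functors *)

Section Concrete.
Variables (C D : category).

(** The morphism parts of two functors live in different types until their
    object parts are identified; packing each morphism with its endpoints makes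
    the hypothesis expressible without transport along [eo]. *)
Lemma functor_eq (F G : functor C D) (eo : forall A, F A = G A) :
  (forall A B (f : mor A B),
     existT (fun AB : D * D => mor AB.1 AB.2) (F A, F B) (fmor F f) =
     existT (fun AB : D * D => mor AB.1 AB.2) (G A, G B) (fmor G f)) ->
  F = G.
Proof.
case: F G eo => [ob m mi mc] [ob' m' mi' mc'] /= /funext eo.
case: _ / eo m' mi' mc' => m' mi' mc' em.
have {}em : m = m'.
  apply: functional_extensionality_dep => A.
  apply: functional_extensionality_dep => B.
  apply: functional_extensionality_dep => f.
  exact: Eqdep.EqdepTheory.inj_pair2 _ _ _ _ _ (em A B f).
case: _ / em mi' mc' => mi' mc'.
by rewrite (Prop_irrelevance mi mi') (Prop_irrelevance mc mc').
Qed.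

Definition faithful (F : functor C D) :=
  forall A B (f g : mor A B), fmor F f = fmor F g -> f = g.

End Concrete.

(** Both morphism parts have the same image under the faithful functor [UD],
    namely the morphism part of [UC]. *)
Lemma concrete_functor_eq (C D : category) (UC : functor C SetCat)
    (UD : functor D SetCat) (F G : functor C D) :
  faithful UD -> is_concrete UC UD F -> is_concrete UC UD G ->
  (forall A, F A = G A) -> F = G.
Proof.
move=> fUD cF cG eo; apply: functor_eq => // A B f.
have {cF cG} : existT (fun XY : Type * Type => XY.1 -> XY.2)
    (UD (F A), UD (F B)) (fmor UD (fmor F f)) =
  existT (fun XY : Type * Type => XY.1 -> XY.2)
    (UD (G A), UD (G B)) (fmor UD (fmor G f)).
  by move: (etrans cF (esym cG)) => /(congr1 (fun H : functor C SetCat =>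
    existT (fun XY : Type * Type => XY.1 -> XY.2) (H A, H B) (fmor H f))).
move: (fmor F f) (fmor G f); rewrite -(eo A) -(eo B) => u v.
move=> uv; have {}uv := Eqdep.EqdepTheory.inj_pair2 _ _ _ _ _ uv.
by rewrite (fUD _ _ _ _ uv).
Qed.

(** * Distributions and families of distances as dual objects *)

Section Duality.
Variable R : realType.
Implicit Types (phi psi : enng R -> R) (d e : level R -> \bar R).
Implicit Types (l : level R) (t : {nonneg R}) (x y : \bar R) (p q c : R).

Lemma level_of p : 0 <= p < 1 -> exists l, 1 - val l = p.
Proof.
move=> /andP[p0 p1].
have h : 0 < 1 - p <= 1 by apply/andP; split; lra.
by exists (exist (fun l : R => is_true (0 < l <= 1)) _ h) => /=; rewrite subKr.
Qed.

Lemma level_itv l : 0 <= 1 - val l < 1.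
Proof. by have /andP[] := valP l; set u := val l; lra. Qed.

Lemma level_itvW l : 0 <= 1 - val l <= 1.
Proof. by have /andP[-> /ltW ->] := level_itv l. Qed.

(** If [q < p], then [q] itself is of the form [1 - l] and separates them. *)
Lemma le_by_levels p q : p <= 1 -> 0 <= q ->
  (forall l, 1 - val l < p -> 1 - val l < q) -> p <= q.
Proof.
move=> p1 q0 pq; rewrite leNgt; apply/negP => qp.
have [|l lq] := @level_of q; first by rewrite q0 (lt_le_trans qp).
by move: (pq l); rewrite lq ltxx => /(_ qp).
Qed.

Lemma le_by_nonneg x y : (0 <= x)%E ->
  (forall t, (x < t%:num%:E)%E -> (y <= t%:num%:E)%E) -> (y <= x)%E.
Proof.
case: x => [r| |] // r0 yt; last by rewrite leey.
apply/lee_addgt0Pr => e e0.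
have re0 : 0 <= r + e by move: r0; rewrite lee_fin; lra.
by apply: (yt (NngNum re0)); rewrite /= lte_fin ltrDl.
Qed.

Lemma enngP (P : enng R -> Prop) :
  (forall s : enng R, val s = +oo%E -> P s) ->
  (forall t, P (enng_fin t)) -> forall s, P s.
Proof.
move=> Poo Pfin [[r| |] r0] //; last exact: Poo.
have r0' : 0 <= r by rewrite -lee_fin.
suff -> : exist _ r%:E r0 = enng_fin (NngNum r0') by [].
exact: val_inj.
Qed.

Definition level_dual phi d := forall l t,
  (1 - val l < phi (enng_fin t)) = (d l < t%:num%:E)%E.

Lemma level_dual_le_dist phi psi d e : level_dual phi d -> level_dual psi e ->
  (forall l, 0 <= d l)%E ->
  (forall s, phi s <= psi s) -> forall l, (e l <= d l)%E.
Proof.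
move=> phid psie d0 phipsi l; apply: le_by_nonneg => // t.
by rewrite -phid => /lt_le_trans/(_ (phipsi _)); rewrite psie => /ltW.
Qed.

Lemma level_dual_le_distr phi psi d e :
  is_distance_distribution phi -> is_distance_distribution psi ->
  level_dual phi d -> level_dual psi e ->
  (forall l, e l <= d l)%E -> forall s, phi s <= psi s.
Proof.
move=> Dphi Dpsi phid psie ed; elim/enngP => [s soo|t].
  by rewrite (ddoo Dphi soo) (ddoo Dpsi soo).
have /andP[_ p1] := dd_itv Dphi (enng_fin t).
have /andP[q0 _] := dd_itv Dpsi (enng_fin t).
apply: le_by_levels => // l.
by rewrite phid psie; apply: le_lt_trans.
Qed.

(** At every [t > 0] the condition [phi t = 1] says that every [1 - l] lies
    below [phi t], that is, that [d l < t] for all [l]. *)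
Lemma level_dual_eps0 phi d : is_distance_distribution phi ->
  level_dual phi d -> (forall l, 0 <= d l)%E ->
  phi = @eps0 R <-> (forall l, d l = 0%E).
Proof.
move=> Dphi phid d0; split=> [phi_eps l|dz].
  apply/eqP; rewrite eq_le d0 andbT.
  apply: le_by_nonneg => // t t0; apply: ltW; rewrite -phid phi_eps.
  by rewrite /eps0 /= gt_eqF//; have /andP[] := level_itv l.
apply/funext; elim/enngP => [s soo|t].
  by rewrite (ddoo Dphi soo) /eps0 soo.
rewrite /eps0 /=; case: eqP => [t0|/eqP t0]; first exact: (dd0 Dphi).
have /andP[p0 p1] := dd_itv Dphi (enng_fin t).
apply: le_anti; rewrite p1 /=; apply: le_by_levels => // l _.
by rewrite phid dz lt_neqAle eq_sym t0 lee_fin ge0.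
Qed.

(** [delta_dist alpha l x y] is [quantile (alpha x y) l] by definition. *)
Definition quantile phi l : \bar R :=
  ereal_inf [set g%:num%:E | g in
    [set g : {nonneg R} | phi (enng_fin g) > 1 - val l]].

Lemma quantile_ge0 phi l : (0 <= quantile phi l)%E.
Proof. by apply: le_ereal_inf_tmp => _ [g _ <-]; rewrite lee_fin. Qed.

(** Left continuity serves the implication from left to right: a strict
    inequality at [t] persists at some [s < t], and [s] bounds the infimum. *)
Lemma quantile_dual phi : is_distance_distribution phi ->
  level_dual phi (quantile phi).
Proof.
move=> Dphi l t; apply/idP/idP => [lt_phi|]; last first.
  move=> /ereal_inf_lt[_ [g /= lg <-] gt]; apply: lt_le_trans lg _.
  by apply: (dd_mono Dphi); rewrite /= ltW.
have t0 : 0 < t%:num.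
  rewrite lt_neqAle ge0 andbT; apply/eqP => t0.
  have /andP[l0 _] := level_itv l.
  move: lt_phi; rewrite (dd0 Dphi) ?ltNge ?l0//=.
  by rewrite -t0.
have := dd_lcont Dphi t0.
have -> : enng_fin `|t%:num|%:nng = enng_fin t.
  by apply: val_inj => /=; rewrite ger0_norm.
move=> /cvgr_gt/(_ _ lt_phi) phi_near.
have [s [s0 [st ls]]] : exists s, 0 < s /\ s < t%:num /\
    1 - val l < phi (enng_fin `|s|%:nng).
  have : \forall s \near t%:num^'-, 0 < s /\ s < t%:num /\
    1 - val l < phi (enng_fin `|s|%:nng).
    near=> s; split; last split.
    - by near: s; exact: nbhs_left_gt.
    - by near: s; exact: nbhs_left_lt.
    - by near: s; exact: phi_near.
  by move=> /filter_ex.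
apply: le_lt_trans (_ : (`|s|%:E < _)%E).
  by apply: ereal_inf_lbound; exists `|s|%:nng.
by rewrite lte_fin gtr0_norm.
Unshelve. all: by end_near. Qed.

(** For finite [s] this is the supremum taken in [0,1]: when no level qualifies,
    the supremum of the empty set of reals is 0, the least element of [0,1].
    The value at infinity is imposed, since [d l] may be infinite for every
    small [l]. *)
Definition profile d (s : enng R) : R :=
  if val s == +oo%E then 1
  else sup [set 1 - val l | l in [set l | d l < val s]%E].

(** Condition (UD) for a single pair of points. *)
Definition level_rcont d := forall l,
  d l = ereal_inf [set d r | r in [set r : level R | val r < val l]].

Lemma profile_has_ubound d (s : enng R) :
  has_ubound [set 1 - val l | l in [set l | d l < val s]%E].
Proof. by exists 1 => _ [l _ <-]; have /andP[_ /ltW] := level_itv l. Qed.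

Lemma profile_itv d s : 0 <= profile d s <= 1.
Proof.
rewrite /profile; case: ifP => _; first by rewrite ler01 lexx.
set S := [set _ | _ in _].
have [->|S0] := eqVneq S set0; first by rewrite sup0 lexx ler01.
move/set0P: S0 => S0; apply/andP; split.
  case: (S0) => c Sc; apply: le_trans (ub_le_sup (profile_has_ubound _ _) Sc).
  by case: Sc => l _ <-; have /andP[] := level_itv l.
by apply: ge_sup => // _ [l _ <-]; have /andP[_ /ltW] := level_itv l.
Qed.

(** A supremum exceeds [1 - l] exactly if some [r < l] satisfies [d r < t];
    by (UD), this is the case exactly if [d l < t]. *)
Lemma profile_dual d : level_rcont d -> level_dual (profile d) d.
Proof.
move=> drc l t; rewrite /profile /=; apply/idP/idP.
  set S := [set _ | _ in _] => lS.
  have S0 : S !=set0.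
    apply/set0P/negP => /eqP S0; move: lS; rewrite S0 sup0.
    by have /andP[? _] := level_itv l; rewrite ltNge => /negP.
  have [_ [r /= rt <-] lr] := sup_gt S0 lS.
  apply: le_lt_trans rt; rewrite drc; apply: ereal_inf_lbound.
  by exists r => //=; move: lr; rewrite ltrD2l ltrN2.
rewrite {1}drc => /ereal_inf_lt[_ [r /= rl <-] rt].
apply: (@lt_le_trans _ _ (1 - val r)).
  by rewrite ltrD2l ltrN2.
apply: ub_le_sup; last by exists r.
exact: (@profile_has_ubound d (enng_fin t)).
Qed.

(** If [c < phi r] for some [c = 1 - l], then [d l < r], so every [s] strictly
    in between has [c < phi s]; and [phi s <= phi r] by monotonicity. *)
Lemma level_dual_lcont phi d : level_dual phi d -> (forall l, 0 <= d l)%E ->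
  (forall s, 0 <= phi s <= 1) ->
  (forall s s' : enng R, (val s <= val s')%E -> phi s <= phi s') ->
  forall r : R, 0 < r ->
  (fun s : R => phi (enng_fin `|s|%:nng)) @ r^'- --> phi (enng_fin `|r|%:nng).
Proof.
move=> phid d0 phi01 phi_le r r0; apply/cvgrPdist_lt => e e0.
have phi_ge0 s : 0 <= phi s by case/andP: (phi01 s).
have phi_le1 s : phi s <= 1 by case/andP: (phi01 s).
set pr := phi (enng_fin `|r|%:nng).
have pr1 : pr <= 1 by apply: phi_le1.
have phi_near : \forall s \near r^'-, pr - e < phi (enng_fin `|s|%:nng).
  (* A negative [pr - e] is not of the form [1 - l], but bounds trivially. *)
  have [c0|c0] := ltP (pr - e) 0.
    near=> s; exact: lt_le_trans c0 (phi_ge0 _).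
  have [|l lc] := @level_of (pr - e).
    by rewrite c0 (lt_le_trans _ pr1)// ltrBlDr ltrDl.
  have : 1 - val l < pr by rewrite lc; lra.
  rewrite phid /= gtr0_norm//; move: (d0 l); case dl: (d l) => [u| |] //.
  rewrite lte_fin lee_fin => u0 ur.
  near=> s; rewrite -lc phid dl lte_fin /=.
  have us : u < s by near: s; exact: nbhs_left_gt.
  by rewrite gtr0_norm// (le_lt_trans u0).
near=> s.
have s0 : 0 < s by near: s; exact: nbhs_left_gt.
have sr : s < r by near: s; exact: nbhs_left_lt.
have ps : pr - e < phi (enng_fin `|s|%:nng) by near: s.
have : phi (enng_fin `|s|%:nng) <= pr.
  by apply: phi_le; rewrite /= lee_fin !gtr0_norm// ltW.
by move=> ?; rewrite ger0_norm ?subr_ge0//; lra.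
Unshelve. all: by end_near. Qed.

Lemma profile_le d (s s' : enng R) : (val s <= val s')%E ->
  profile d s <= profile d s'.
Proof.
move=> ss'; have [s'oo|s'oo] := eqVneq (val s') +oo%E.
  by rewrite {2}/profile s'oo eqxx; have /andP[] := profile_itv d s.
have /negPf soo : val s != +oo%E.
  by apply: contra s'oo => /eqP soo; rewrite -leye_eq -soo.
have /andP[p0 _] := profile_itv d s'.
move: p0; rewrite /profile soo (negPf s'oo).
set S := [set _ | _ in _] => p0; set S' := [set _ | _ in _].
have [S0|/set0P S0] := eqVneq S' set0; first by rewrite S0 sup0.
apply: ge_sup => // c [l /= ls <-]; apply: ub_le_sup.
  exact: profile_has_ubound.
by exists l => //=; apply: lt_le_trans ss'.
Qed.

Lemma profile_distribution d : level_rcont d -> (forall l, 0 <= d l)%E ->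
  is_distance_distribution (profile d).
Proof.
move=> drc d0; have dual := profile_dual drc.
split.
- exact: profile_itv.
- exact: profile_le.
- move=> t t0; rewrite /profile t0 /=.
  set S := [set _ | _ in _]; suff -> : S = set0 by rewrite sup0.
  by apply/seteqP; split=> // c [l /=]; rewrite ltNge d0.
- by move=> t too; rewrite /profile too eqxx.
- exact: (level_dual_lcont dual d0 (profile_itv _) (@profile_le d)).
Qed.

Lemma quantile_profile d : level_rcont d -> (forall l, 0 <= d l)%E ->
  quantile (profile d) = d.
Proof.
move=> drc d0; have Dp := profile_distribution drc d0.
have qd := quantile_dual Dp; have pd := profile_dual drc.
apply/funext => l; apply/eqP; rewrite eq_le; apply/andP; split.
  exact: (level_dual_le_dist pd qd).
by apply: (level_dual_le_dist qd pd) => // ?; apply: quantile_ge0.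
Qed.

(** If [1 - l < phi g], some [c = 1 - r] lies strictly in between, so
    [g] also enters the infimum for some [r < l]. *)
Lemma quantile_rcont phi : level_rcont (quantile phi).
Proof.
move=> l; apply/eqP; rewrite eq_le; apply/andP; split.
  apply: le_ereal_inf_tmp => _ [r /= rl <-].
  apply: ereal_inf_le_tmp => _ [g /= rg <-]; exists g => //=.
  by apply: le_lt_trans rg; rewrite lerB// ltW.
apply: le_ereal_inf_tmp => _ [g /= lg <-].
have /andP[l0 l1] := level_itv l.
have [c [/andP[c0 c1] lc cg]] : exists c,
    [/\ 0 <= c < 1, 1 - val l < c & c < phi (enng_fin g)].
  (* The minimum keeps the midpoint below 1 even where [phi g] exceeds 1. *)
  exists ((1 - val l + Num.min 1 (phi (enng_fin g))) / 2).
  have : 1 - val l < Num.min 1 (phi (enng_fin g)) by rewrite lt_min l1.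
  have : Num.min 1 (phi (enng_fin g)) <= 1 by rewrite ge_min lexx.
  have : Num.min 1 (phi (enng_fin g)) <= phi (enng_fin g).
    by rewrite ge_min lexx orbT.
  move: (Num.min _ _) => m m1 m2 m3.
  by split; [apply/andP; split|..]; lra.
have [|r rc] := @level_of c; first by rewrite c0.
apply: (@le_trans _ _ (quantile phi r)).
  apply: ereal_inf_lbound; exists r => //=.
  by move: lc; rewrite -rc ltrD2l ltrN2.
by apply: ereal_inf_lbound; exists g => //=; rewrite rc.
Qed.

Lemma profile_quantile phi : is_distance_distribution phi ->
  profile (quantile phi) = phi.
Proof.
move=> Dphi; have Dp := profile_distribution (@quantile_rcont phi)
  (quantile_ge0 phi).
have qd := quantile_dual Dphi; have pd := profile_dual (@quantile_rcont phi).
apply/funext => s; apply/eqP; rewrite eq_le; apply/andP; split.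
  exact: (level_dual_le_distr Dp Dphi pd qd).
exact: (level_dual_le_distr Dphi Dp qd pd).
Qed.

End Duality.

(** * Transfer of the axioms *)

Section Objects.
Variable R : realType.
Implicit Types (T : R -> R -> R) (p q c : R).

Lemma tnorm_lt_nbhs T p q c : is_cont_tnorm T ->
  0 <= p <= 1 -> 0 <= q <= 1 -> c < T p q ->
  exists2 e, 0 < e & forall p' q', 0 <= p' <= 1 -> 0 <= q' <= 1 ->
    `|p - p'| < e -> `|q - q'| < e -> c < T p' q'.
Proof.
move=> tT p01 q01 cpq.
have sq (u v : R) : 0 <= u <= 1 -> 0 <= v <= 1 -> (`[0, 1] `*` `[0, 1]) (u, v).
  by move=> u01 v01; split; rewrite /= in_itv.
have /subspace_continuousP/(_ (p, q) (sq _ _ p01 q01)) := tnorm_cont tT.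
move=> /cvgr_gt/(_ _ cpq); rewrite near_withinE => /nbhs_ballP[e /= e0 near_pq].
exists e => // p' q' p'01 q'01 pp' qq'.
by apply: (near_pq (p', q')); [split | exact: sq].
Qed.

Lemma tnorm0 T q : is_cont_tnorm T -> 0 <= q <= 1 -> T 0 q = 0.
Proof.
move=> tT q01; have /andP[_ q1] := q01.
have i0 : 0 <= (0 : R) <= 1 by rewrite lexx ler01.
have i1 : 0 <= (1 : R) <= 1 by rewrite lexx ler01.
apply: le_anti; apply/andP; split; last by have /andP[] := tnorm_itv tT i0 q01.
rewrite -[leRHS](tnorm1 tT i0) [leRHS](tnormC tT)//.
exact: (tnorm_le tT).
Qed.

Lemma approx_level p e : 0 < p <= 1 -> 0 < e ->
  exists2 l : level R, 1 - val l < p & `|p - (1 - val l)| < e.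
Proof.
move=> /andP[p0 p1] e0; pose m := Num.min (p / 2) (e / 2).
have mp : m <= p / 2 by rewrite /m ge_min lexx.
have me : m <= e / 2 by rewrite /m ge_min lexx orbT.
have m0 : 0 < m by rewrite /m lt_min; apply/andP; split; lra.
have [|l lE] := @level_of R (p - m); first by apply/andP; split; lra.
by exists l; rewrite lE ?subKr ?gtr0_norm//; lra.
Qed.

(** For (UT), let [d] be [delta_dist alpha]: points [r] and [s] slightly above
    [d l x y] and [d l' y z] satisfy [1 - l < alpha x y r] and
    [1 - l' < alpha y z s], so monotonicity of the t-norm and (P5) give [1 - e < alpha x z (s + r)]. *)
Lemma delta_zfamily (X : Type) (alpha : X -> X -> enng R -> R) :
  is_probmet alpha -> is_zfamily (delta_dist alpha).
Proof.
move=> [T [tT aP]].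
have dual x y : level_dual (alpha x y) (fun l => delta_dist alpha l x y).
  exact: quantile_dual (pm_P1 aP x y).
have d0 l x y : (0 <= delta_dist alpha l x y)%E by exact: quantile_ge0.
split=> //.
- move=> l x; move: l; apply/(level_dual_eps0 (pm_P1 aP x x) (dual x x)) => //.
  exact: (pm_P2 aP).
- move=> l x y; apply: (congr1 (fun phi => quantile phi l)); apply/funext => r.
  exact: (pm_P3 aP).
- by move=> l x y; exact: quantile_rcont.
- exists T; split=> // e l l' lT x y z.
  have [p01 q01] := (dd_itv (pm_P1 aP y z), dd_itv (pm_P1 aP x y)).
  move: (dual x y l) (dual y z l').
  move: (d0 l x y) (d0 l' y z).
  case: (delta_dist alpha l x y) => [u| |] //; last first.
    by case: (delta_dist alpha l' y z) => [v| |] // *; rewrite addye ?leey.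
  case: (delta_dist alpha l' y z) => [v| |] //; last by rewrite addey ?leey.
  rewrite !lee_fin => u0 v0 du dv; apply/lee_addgt0Pr => h h0.
  have r0 : 0 <= u + h / 2 by lra.
  have s0 : 0 <= v + h / 2 by lra.
  have lr := du (NngNum r0); have ls := dv (NngNum s0).
  have {}lr : 1 - val l < alpha x y (enng_fin (NngNum r0)).
    by rewrite lr lte_fin /=; lra.
  have {}ls : 1 - val l' < alpha y z (enng_fin (NngNum s0)).
    by rewrite ls lte_fin /=; lra.
  have -> : (u%:E + v%:E + h%:E)%E =
      ((NngNum s0)%:num + (NngNum r0)%:num)%:nng%:num%:E.
    by rewrite /= -!EFinD; congr EFin; lra.
  apply: ltW; rewrite -dual.
  apply: lt_le_trans lT _.
  have -> : enng_fin ((NngNum s0)%:num + (NngNum r0)%:num)%:nng =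
      enng_add (enng_fin (NngNum s0)) (enng_fin (NngNum r0)).
    by apply: val_inj => /=; rewrite EFinD.
  apply: le_trans (pm_P5 aP x y z _ _); apply: (tnorm_le tT) => //.
  - exact: level_itvW.
  - exact: level_itvW.
  - exact: ltW.
  - exact: ltW.
- move=> x y xy; apply: contrapT => nd; apply: xy; apply: (pm_P4 aP).
  apply/(level_dual_eps0 (pm_P1 aP x y) (dual x y)) => // l.
  apply/eqP; rewrite eq_le d0 andbT leNgt; apply/negP => dl.
  by apply: nd; exists l.
Qed.

Definition nabla_distr (X : Type) (d : level R -> X -> X -> \bar R) (x y : X) :
  enng R -> R := profile (d ^~ x ^~ y).

(** For (P5), suppose [c < T p q], where [p], [q], [c] are the values at [r],
    [s], [r + s].  By continuity, [c < T (1 - l') (1 - l)] for some levels with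
    [1 - l' < p] and [1 - l < q], and some [1 - k] lies strictly between the two
    sides.  Then (UT) gives [d k x z <= d l x y + d l' y z < s + r], that is,
    [1 - k < c], a contradiction. *)
Lemma nabla_probmet (X : Type) (d : level R -> X -> X -> \bar R) :
  is_zfamily d -> is_probmet (nabla_distr d).
Proof.
move=> dP; have [T [tT dT]] := z_UT dP; exists T; split=> //.
have rc x y : level_rcont (d ^~ x ^~ y) by move=> l; exact: (z_UD dP).
have d0 x y l : (0 <= d l x y)%E by exact: (z_ge0 dP).
have dual x y : level_dual (nabla_distr d x y) (d ^~ x ^~ y).
  exact: profile_dual (rc x y).
have Dp x y : is_distance_distribution (nabla_distr d x y).
  exact: profile_distribution.
split=> //.
- move=> x; apply/(level_dual_eps0 (Dp x x) (dual x x)) => // l.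
  exact: (z_diag dP).
- move=> x y r; congr (profile _ r); apply/funext => l; exact: (z_US dP).
- move=> x y /(level_dual_eps0 (Dp x y) (dual x y) (d0 x y)) dz.
  by apply: contrapT => /(z_UH dP)[l]; rewrite dz ltxx.
- move=> x y z.
  have T_le1 r s : T (nabla_distr d y z r) (nabla_distr d x y s) <= 1.
    by case/andP: (tnorm_itv tT (dd_itv (Dp y z) r) (dd_itv (Dp x y) s)).
  elim/enngP => [r roo s|r].
    suff -> : nabla_distr d x z (enng_add r s) = 1 by [].
    by apply: (ddoo (Dp x z)); rewrite /= roo; case: s => [[s| |] s0].
  elim/enngP => [s soo|s].
    suff -> : nabla_distr d x z (enng_add (enng_fin r) s) = 1 by [].
    by apply: (ddoo (Dp x z)); rewrite /= soo addey.
  have -> : enng_add (enng_fin r) (enng_fin s) =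
      enng_fin (r%:num + s%:num)%:nng.
    by apply: val_inj => /=; rewrite EFinD.
  set p := nabla_distr d y z _; set q := nabla_distr d x y _.
  set c := nabla_distr d x z _.
  have p01 : 0 <= p <= 1 := dd_itv (Dp y z) _.
  have q01 : 0 <= q <= 1 := dd_itv (Dp x y) _.
  have /andP[c0 c1] : 0 <= c <= 1 := dd_itv (Dp x z) _.
  (* No [1 - l] lies below a zero factor, but then the product is zero. *)
  have [p0|p0] := eqVneq p 0; first by rewrite p0 tnorm0.
  have [q0|q0] := eqVneq q 0; first by rewrite (tnormC tT)// q0 tnorm0.
  rewrite leNgt; apply/negP => cT.
  have [e e0 near_pq] := tnorm_lt_nbhs tT p01 q01 cT.
  have [|l' l'p pl'] := @approx_level p e _ e0.
    by case/andP: p01 => p_ge0 ->; rewrite lt_neqAle eq_sym p0 p_ge0.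
  have [|l lq ql] := @approx_level q e _ e0.
    by case/andP: q01 => q_ge0 ->; rewrite lt_neqAle eq_sym q0 q_ge0.
  have cll := near_pq _ _ (level_itvW l') (level_itvW l) pl' ql.
  have /andP[_ T1] := tnorm_itv tT (level_itvW l') (level_itvW l).
  move: cll T1 (dT ^~ l ^~ l'); set m := T _ _ => cm m1 dT'.
  have [|k kE] := @level_of R ((c + m) / 2); first by apply/andP; split; lra.
  have : 1 - val k < c.
    rewrite dual; apply: (@le_lt_trans _ _ (d l x y + d l' y z)%E).
      by apply: dT'; rewrite kE; lra.
    rewrite /= EFinD [ltRHS]addeC; apply: lteD.
      by rewrite -dual.
    by rewrite -dual.
  by rewrite kE; lra.
Qed.

End Objects.

(** * The functors and their composites *)

Lemma ProbMet_forget_faithful R : faithful (ProbMet_forget R).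
Proof. by move=> A B f g; exact: pm_hom_eq. Qed.

Lemma ZCat_forget_faithful R : faithful (ZCat_forget R).
Proof. by move=> A B f g; exact: z_hom_eq. Qed.

Section Functors.
Variable R : realType.

Lemma ProbMetSpace_eq (X : Type) (a b : X -> X -> enng R -> R)
  (aP : is_probmet a) (bP : is_probmet b) :
  a = b -> ProbMetSpace aP = ProbMetSpace bP.
Proof.
by move=> ab; case: _ / ab bP => bP; rewrite (Prop_irrelevance aP bP).
Qed.

Lemma ZSpace_eq (X : Type) (d e : level R -> X -> X -> \bar R)
  (dP : is_zfamily d) (eP : is_zfamily e) :
  d = e -> ZSpace dP = ZSpace eP.
Proof.
by move=> de; case: _ / de eP => eP; rewrite (Prop_irrelevance dP eP).
Qed.

Lemma pm_distribution (A : probmet R) (x y : A) :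
  is_distance_distribution (pm_alpha x y).
Proof. by have [T [_ /pm_P1]] := pm_ax A. Qed.

Definition Delta_obj (A : ProbMet R) : ZCat R :=
  ZSpace (delta_zfamily (pm_ax A)).

Definition Nabla_obj (A : ZCat R) : ProbMet R :=
  ProbMetSpace (nabla_probmet (z_ax A)).

Lemma Delta_le (A B : ProbMet R) (f : mor A B) l (x x' : A) :
  (delta_dist (@pm_alpha R B) l (f x) (f x') <=
   delta_dist (@pm_alpha R A) l x x')%E.
Proof.
apply: (level_dual_le_dist (quantile_dual (pm_distribution x x'))
  (quantile_dual (pm_distribution (f x) (f x')))).
  exact: quantile_ge0.
exact: pm_fun_le.
Qed.

Lemma Nabla_le (A B : ZCat R) (f : mor A B) (x x' : A) t :
  nabla_distr (@z_dist R A) x x' t <= nabla_distr (@z_dist R B) (f x) (f x') t.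
Proof.
have rc (C : ZCat R) (y y' : C) : level_rcont (fun l => z_dist l y y').
  by move=> l; exact: (z_UD (z_ax C)).
have d0 (C : ZCat R) (y y' : C) l : (0 <= z_dist l y y')%E.
  exact: (z_ge0 (z_ax C)).
apply: (level_dual_le_distr (profile_distribution (rc _ _ _) (d0 _ _ _))
  (profile_distribution (rc _ _ _) (d0 _ _ _))
  (profile_dual (rc _ _ _)) (profile_dual (rc _ _ _))).
by move=> l; exact: z_fun_le.
Qed.

Definition Delta_mor (A B : ProbMet R) (f : mor A B) :
    mor (Delta_obj A) (Delta_obj B) :=
  @ZHom R (Delta_obj A) (Delta_obj B) f (Delta_le f).

Definition Nabla_mor (A B : ZCat R) (f : mor A B) :
    mor (Nabla_obj A) (Nabla_obj B) :=
  @PMHom R (Nabla_obj A) (Nabla_obj B) f (Nabla_le f).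

Lemma Delta_id (A : ProbMet R) : Delta_mor (mor_id A) = mor_id (Delta_obj A).
Proof. exact: z_hom_eq. Qed.

Lemma Delta_comp (A B E : ProbMet R) (g : mor B E) (f : mor A B) :
  Delta_mor (mor_comp g f) = mor_comp (Delta_mor g) (Delta_mor f).
Proof. exact: z_hom_eq. Qed.

Definition Delta : functor (ProbMet R) (ZCat R) := Functor Delta_id Delta_comp.

Lemma Nabla_id (A : ZCat R) : Nabla_mor (mor_id A) = mor_id (Nabla_obj A).
Proof. exact: pm_hom_eq. Qed.

Lemma Nabla_comp (A B E : ZCat R) (g : mor B E) (f : mor A B) :
  Nabla_mor (mor_comp g f) = mor_comp (Nabla_mor g) (Nabla_mor f).
Proof. exact: pm_hom_eq. Qed.

Definition Nabla : functor (ZCat R) (ProbMet R) := Functor Nabla_id Nabla_comp.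

Lemma Delta_concrete : is_concrete (ProbMet_forget R) (ZCat_forget R) Delta.
Proof. exact: functor_eq. Qed.

Lemma NablaK (A : probmet R) : Nabla (Delta A) = A.
Proof.
case: A => X a aP; apply: ProbMetSpace_eq.
apply/funext => x; apply/funext => y; apply: profile_quantile.
exact: (@pm_distribution (ProbMetSpace aP)).
Qed.

Lemma DeltaK (A : zspace R) : Delta (Nabla A) = A.
Proof.
case: A => X d dP; apply: ZSpace_eq.
apply/funext => l; apply/funext => x; apply/funext => y.
have := @quantile_profile R (d ^~ x ^~ y); move/(_ _ _)/(congr1 (@^~ l)); apply.
  by move=> k; exact: (z_UD dP).
by move=> k; exact: (z_ge0 dP).
Qed.

Lemma Delta_is_isomorphism : is_isomorphism Delta.
Proof.
exists Nabla; split.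
  apply: (concrete_functor_eq (@ProbMet_forget_faithful R)
    (UC := ProbMet_forget R)); [exact: functor_eq..|exact: NablaK].
apply: (concrete_functor_eq (@ZCat_forget_faithful R)
  (UC := ZCat_forget R)); [exact: functor_eq..|exact: DeltaK].
Qed.

End Functors.

Theorem theorem5p4 (R : realType) :
  exists Delta : functor (ProbMet R) (ZCat R),
    is_Delta Delta /\ is_isomorphism Delta.
Proof.
exists (Delta R); split; last exact: Delta_is_isomorphism.
split; first exact: Delta_concrete.
by move=> A; exists (delta_zfamily (pm_ax A)).
Qed.
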